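(* Let $n\ge 5$ be an odd integer, and consider a rectangle in the square lattice that has a side of length divisible by $n$ and a side of even length. (1) If one side has length divisible by $n$ and the other side has even length, then the rectangle can be tiled by $\mathcal{T}_n$. (2) If the side of length divisible by $n$ has length that is even and at least $3n+1$, and the other side has length that is odd and at least $3n$, then the rectangle can be tiled by $\mathcal{T}_n$.
   Context: Work in the square lattice; a cell is a unit square, identified with the integer coordinates $(\alpha,\beta)\in\mathbb{Z}^2$ of its lower left corner. $\mathcal{T}_n=\{T_1,T_2,T_3,T_4\}$ is the set of ribbon $L$-shaped $n$-ominoes, where, as sets of $n$ cells, $T_1=\{(0,j):0\le j\le n-2\}\cup\{(1,0)\}$, $T_2=\{(1,j):0\le j\le n-2\}\cup\{(0,n-2)\}$, $T_3=\{(i,0):0\le i\le n-2\}\cup\{(0,1)\}$, $T_4=\{(i,1):0\le i\le n-2\}\cup\{(n-2,0)\}$. Only translates of the tiles by integer vectors are allowed. A rectangle has positive integer side lengths and is viewed as a set of cells. A region can be tiled by $\mathcal{T}_n$ (a regular tiling) if it is a disjoint union of translates of tiles of $\mathcal{T}_n$. *)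

(* Defs.v *)
From mathcomp Require Import all_boot all_order all_algebra.
From mathcomp Require Import classical_sets.

Set Implicit Arguments.
Unset Strict Implicit.
Unset Printing Implicit Defensive.

Import Order.TTheory GRing.Theory Num.Theory.

Local Open Scope classical_set_scope.
Local Open Scope ring_scope.

(* A unit square of the lattice, given by its lower left corner. *)
Definition cell : Type := (int * int)%type.

Definition region : Type := set cell.

(* The bounds 0 <= j <= n - 2 are integer inequalities, so no truncated
   subtraction is involved. *)
Definition T1 (n : nat) : region :=
  [set (0, j) | j in [set j : int | 0 <= j <= n%:Z - 2]] `|` [set (1, 0)].

Definition T2 (n : nat) : region :=
  [set (1, j) | j in [set j : int | 0 <= j <= n%:Z - 2]]
  `|` [set (0, n%:Z - 2)].

Definition T3 (n : nat) : region :=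
  [set (i, 0) | i in [set i : int | 0 <= i <= n%:Z - 2]] `|` [set (0, 1)].

Definition T4 (n : nat) : region :=
  [set (i, 1) | i in [set i : int | 0 <= i <= n%:Z - 2]]
  `|` [set (n%:Z - 2, 0)].

Definition ribbonL (n : nat) : set region := [set T1 n; T2 n; T3 n; T4 n].

Definition translate (v : int * int) (A : region) : region :=
  [set (x.1 + v.1, x.2 + v.2) | x in A].

Definition placed (Ts : set region) : set region :=
  [set A | exists T v, Ts T /\ A = translate v T].

(* The tiles of P are pairwise disjoint with union A. [partition] also asks
   them to be nonempty, which all ribbon L-shaped tiles are. *)
Definition tileable (Ts : set region) (A : region) : Prop :=
  exists P : set region, P `<=` placed Ts /\ partition P id A.

(* Width w, height h; c is the lower left cell. *)
Definition rectangle (c : cell) (w h : nat) : region :=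
  [set x : cell | (c.1 <= x.1 < c.1 + w%:Z) && (c.2 <= x.2 < c.2 + h%:Z)].

(* Main.v *)
(** Two ribbon L-shaped tiles of the same orientation fill an n x 2 or a 2 x n
    rectangle, which gives (1).  For (2), cut off n rows (resp. columns): this
    strip falls under (1) because the side divisible by n is also even, and the
    rest falls under (1) because its other side is a difference of odd numbers. *)
Require Import Defs.
From mathcomp Require Import all_boot all_order all_algebra.
From mathcomp Require Import classical_sets.
From mathcomp Require Import zify.

Section Tileable.
Local Open Scope classical_set_scope.

(** The empty family of tiles works. This starts the inductions that pile up blocks. *)
Lemma tileable0 (Ts : set region) : tileable Ts set0.
Proof.
exists set0; split=> //; split=> //.
by rewrite /cover bigcup_set0.
Qed.

Lemma tileableU (Ts : set region) (A B : region) :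
  A `&` B = set0 -> tileable Ts A -> tileable Ts B -> tileable Ts (A `|` B).
Proof.
move=> AB0 [P [PTs [PA Ptriv P0]]] [Q [QTs [QB Qtriv Q0]]].
(* A common cell of a tile of [P] and a tile of [Q] would lie in both [A] and [B]. This settles the
   mixed cases of disjointness for the family [P] united with [Q]. *)
have PQ0 X Y : P X -> Q Y -> X `&` Y !=set0 -> False.
  move=> PX QY [x [Xx Yx]]; suff: (A `&` B) x by rewrite AB0.
  by split; [rewrite -PA; exists X | rewrite -QB; exists Y].
exists (P `|` Q); split; first by move=> X [/PTs|/QTs].
split; first by rewrite /cover bigcup_setU; congr (_ `|` _).
- move=> X Y [PX|QX] [PY|QY] XY; first exact: Ptriv.
  + by case: (PQ0 X Y).
  + by case: (PQ0 Y X) => //; rewrite setIC.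
  + exact: Qtriv.
- by move=> X [/P0|/Q0].
Qed.

Lemma tileable_placed (Ts : set region) (A : region) :
  placed Ts A -> A !=set0 -> tileable Ts A.
Proof.
move=> TsA A0; exists [set A]; split; first by move=> _ ->.
split; first by rewrite /cover bigcup_set1.
- by move=> X Y -> ->.
- by move=> _ ->.
Qed.

End Tileable.

Section Rectangles.
Import Order.TTheory GRing.Theory Num.Theory.
Local Open Scope classical_set_scope.
Local Open Scope ring_scope.
Variable Ts : set region.

Lemma tileable_rectangle_addw (c : cell) (w1 w2 h : nat) :
  tileable Ts (rectangle c w1 h) ->
  tileable Ts (rectangle (c.1 + w1%:Z, c.2) w2 h) ->
  tileable Ts (rectangle c (w1 + w2) h).
Proof.
move=> t1 t2.
have -> : rectangle c (w1 + w2) h =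
    rectangle c w1 h `|` rectangle (c.1 + w1%:Z, c.2) w2 h.
  apply/seteqP; rewrite /rectangle; split=> -[x y] /=; last by case; lia.
  by case: (ltrP x (c.1 + w1%:Z)) => ?; [left|right]; lia.
apply: tileableU => //.
by apply/seteqP; rewrite /rectangle; split=> -[x y] //= [/=]; lia.
Qed.

Lemma tileable_rectangle_addh (c : cell) (w h1 h2 : nat) :
  tileable Ts (rectangle c w h1) ->
  tileable Ts (rectangle (c.1, c.2 + h1%:Z) w h2) ->
  tileable Ts (rectangle c w (h1 + h2)).
Proof.
move=> t1 t2.
have -> : rectangle c w (h1 + h2) =
    rectangle c w h1 `|` rectangle (c.1, c.2 + h1%:Z) w h2.
  apply/seteqP; rewrite /rectangle; split=> -[x y] /=; last by case; lia.
  by case: (ltrP y (c.2 + h1%:Z)) => ?; [left|right]; lia.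
apply: tileableU => //.
by apply/seteqP; rewrite /rectangle; split=> -[x y] //= [/=]; lia.
Qed.

(** A [k] by [l] grid of blocks, built as a row of [k] blocks and then [l] such rows stacked. Each
    induction moves the corner, so the block must be tileable at every position. *)
Lemma tileable_rectangle_mul (w h k l : nat) (c : cell) :
  (forall c', tileable Ts (rectangle c' w h)) ->
  tileable Ts (rectangle c (k * w) (l * h)).
Proof.
move=> t.
have row c' : tileable Ts (rectangle c' (k * w) h).
  elim: k c' => [|k IH] c'; last by rewrite mulSn; apply: tileable_rectangle_addw.
  suff -> : rectangle c' (0 * w) h = set0 by exact: tileable0.
  by apply/seteqP; rewrite /rectangle; split=> -[x y] //=; lia.
elim: l c => [|l IH] c; last by rewrite mulSn; apply: tileable_rectangle_addh.
suff -> : rectangle c (k * w) (0 * h) = set0 by exact: tileable0.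
by apply/seteqP; rewrite /rectangle; split=> -[x y] //=; lia.
Qed.

End Rectangles.

Section RibbonL.
Import Order.TTheory GRing.Theory Num.Theory.
Local Open Scope classical_set_scope.
Local Open Scope ring_scope.
Variable n : nat.

(** Together with the four descriptions of the tiles below, this turns membership in a placed tile
    into linear integer arithmetic, which [lia] decides. *)
Lemma translateE (v : int * int) (A : region) (x : cell) :
  translate v A x <-> A (x.1 - v.1, x.2 - v.2).
Proof.
split=> [[[a b] Aab <-]|Ax] /=; first by rewrite !addrK.
by exists (x.1 - v.1, x.2 - v.2) => //=; rewrite !subrK; case: x {Ax}.
Qed.

Lemma T1E (x y : int) :
  T1 n (x, y) <-> (x == 0) && (0 <= y <= n%:Z - 2) || (x == 1) && (y == 0).
Proof.
split=> [[[j /= ? [<- <-]]|[-> ->]]|/orP[/andP[/eqP-> ?]|/andP[/eqP-> /eqP->]]].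
- lia.
- lia.
- by left; exists y.
- by right.
Qed.

Lemma T2E (x y : int) :
  T2 n (x, y) <->
  (x == 1) && (0 <= y <= n%:Z - 2) || (x == 0) && (y == n%:Z - 2).
Proof.
split=> [[[j /= ? [<- <-]]|[-> ->]]|/orP[/andP[/eqP-> ?]|/andP[/eqP-> /eqP->]]].
- lia.
- lia.
- by left; exists y.
- by right.
Qed.

Lemma T3E (x y : int) :
  T3 n (x, y) <-> (y == 0) && (0 <= x <= n%:Z - 2) || (x == 0) && (y == 1).
Proof.
split=> [[[j /= ? [<- <-]]|[-> ->]]|/orP[/andP[/eqP-> ?]|/andP[/eqP-> /eqP->]]].
- lia.
- lia.
- by left; exists x.
- by right.
Qed.

Lemma T4E (x y : int) :
  T4 n (x, y) <->
  (y == 1) && (0 <= x <= n%:Z - 2) || (x == n%:Z - 2) && (y == 0).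
Proof.
split=> [[[j /= ? [<- <-]]|[-> ->]]|/orP[/andP[/eqP-> ?]|/andP[/eqP-> /eqP->]]].
- lia.
- lia.
- by left; exists x.
- by right.
Qed.

(** Covering and disjointness are asked cell by cell, so that both become arithmetic goals for
    concrete tiles. *)
Lemma tileable_two_tiles (T T' : region) (v v' : int * int) (A : region) :
  ribbonL n T -> ribbonL n T' -> T !=set0 -> T' !=set0 ->
  (forall x, A x <-> translate v T x \/ translate v' T' x) ->
  (forall x, translate v T x -> translate v' T' x -> False) ->
  tileable (ribbonL n) A.
Proof.
move=> nT nT' [t Tt] [t' Tt'] AE TT'.
have -> : A = translate v T `|` translate v' T'.
  by apply/seteqP; split=> x /AE.
apply: tileableU.
- by apply/seteqP; split=> // x [/TT'].
- apply: tileable_placed; first by exists T, v.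
  by exists (t.1 + v.1, t.2 + v.2), t.
- apply: tileable_placed; first by exists T', v'.
  by exists (t'.1 + v'.1, t'.2 + v'.2), t'.
Qed.

Hypothesis n_gt1 : (1 < n)%N.

Lemma tileable_rectangle_n2 (c : cell) : tileable (ribbonL n) (rectangle c n 2).
Proof.
(* Relative to [c], [T3] takes columns 0 to n - 2 of the bottom row and the top left cell. Shifted
   right by one, [T4] takes columns 1 to n - 1 of the top row and the bottom right cell. *)
apply: (@tileable_two_tiles (T3 n) (T4 n) c (c.1 + 1, c.2)).
- by left; right.
- by right.
- by exists (0, 1); right.
- by exists (n%:Z - 2, 0); right.
- by move=> [x y]; rewrite !translateE T3E T4E /rectangle /=; lia.
- by move=> [x y]; rewrite !translateE T3E T4E /=; lia.
Qed.

Lemma tileable_rectangle_2n (c : cell) : tileable (ribbonL n) (rectangle c 2 n).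
Proof.
(* The same picture reflected in the diagonal: [T2] is shifted up by one to interlock with [T1]. *)
apply: (@tileable_two_tiles (T1 n) (T2 n) c (c.1, c.2 + 1)).
- by left; left; left.
- by left; left; right.
- by exists (1, 0); right.
- by exists (0, n%:Z - 2); right.
- by move=> [x y]; rewrite !translateE T1E T2E /rectangle /=; lia.
- by move=> [x y]; rewrite !translateE T1E T2E /=; lia.
Qed.

Lemma tileable_rectangle_dvdn_even (c : cell) (w h : nat) :
  (n %| w)%N -> ~~ odd h -> tileable (ribbonL n) (rectangle c w h).
Proof.
move=> /dvdnP[k ->] h_even; rewrite -(even_halfK h_even) -muln2.
by apply: tileable_rectangle_mul => c'; apply: tileable_rectangle_n2.
Qed.

Lemma tileable_rectangle_even_dvdn (c : cell) (w h : nat) :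
  ~~ odd w -> (n %| h)%N -> tileable (ribbonL n) (rectangle c w h).
Proof.
move=> w_even /dvdnP[k ->]; rewrite -(even_halfK w_even) -muln2.
by apply: tileable_rectangle_mul => c'; apply: tileable_rectangle_2n.
Qed.

End RibbonL.

Theorem theorem4 (n : nat) (n_ge5 : (5 <= n)%N) (n_odd : odd n)
    (c : cell) (w h : nat) (w_gt0 : (0 < w)%N) (h_gt0 : (0 < h)%N)
    (side_dvd : (n %| w)%N \/ (n %| h)%N)
    (side_even : ~~ odd w \/ ~~ odd h) :
  (((n %| w)%N /\ ~~ odd h) \/ ((n %| h)%N /\ ~~ odd w) ->
     tileable (ribbonL n) (rectangle c w h))
  /\
  (([/\ (n %| w)%N, ~~ odd w, (3 * n + 1 <= w)%N, odd h & (3 * n <= h)%N]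
    \/ [/\ (n %| h)%N, ~~ odd h, (3 * n + 1 <= h)%N, odd w & (3 * n <= w)%N]) ->
     tileable (ribbonL n) (rectangle c w h)).
Proof.
have n_gt1 : (1 < n)%N by lia.
split=> [[[nw h_even]|[nh w_even]]|[[nw w_even _ h_odd h_ge]|[nh h_even _ w_odd w_ge]]].
- exact: tileable_rectangle_dvdn_even.
- exact: tileable_rectangle_even_dvdn.
- have -> : h = (n + (h - n))%N by lia.
  apply: tileable_rectangle_addh; first exact: tileable_rectangle_even_dvdn.
  by apply: tileable_rectangle_dvdn_even => //; lia.
- have -> : w = (n + (w - n))%N by lia.
  apply: tileable_rectangle_addw; first exact: tileable_rectangle_dvdn_even.
  by apply: tileable_rectangle_even_dvdn => //; lia.
Qed.
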